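(* Let $X$ be a standardized abelian Cayley graph with a Heuberger matrix \[M_X=\begin{pmatrix} y_{11} & 0\\ y_{21} & y_{22}\\ y_{31} & y_{32}\end{pmatrix}\] in modified Hermite normal form. (1) If the first column of $M_X$ is $e_1=(1,0,0)^t$ or the second column of $M_X$ is $e_3=(0,0,1)^t$, then $X$ has loops and cannot be properly colored. (2) If $y_{11}+y_{21}+y_{31}$ and $y_{22}+y_{32}$ are both even, then $\chi(X)=2$. (3) If $M_X$ is of one of the following six types, then $\chi(X)=4$: \[\begin{pmatrix}1&0\\0&1\\ \pm 3k&1+3k\end{pmatrix},\quad \begin{pmatrix}1&0\\0&-1\\ \pm 3k&-1+3k\end{pmatrix},\quad \begin{pmatrix}1&0\\-1&2\\ -1-3k&2+3k\end{pmatrix},\quad \begin{pmatrix}1&0\\-1&-2\\ -1+3k&-2+3k\end{pmatrix}\] for some positive integer $k$; or \[\begin{pmatrix}1&0\\0&-1\\ 3b&2\end{pmatrix}\] for some nonzero integer $b$; or \[\begin{pmatrix}1&0\\-1&a\\ -1&a+3(k-1)\end{pmatrix}\] for some integer $a$ with $3\nmid a$ and some positive integer $k$. (4) If none of the conditions in (1), (2), (3) holds, then $\chi(X)=3$.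
   Context: For an $m\times r$ integer matrix $M$, let $H\subseteq\mathbb{Z}^m$ be the subgroup generated by the columns of $M$, let $e_1,\dots,e_m$ be the standard basis of $\mathbb{Z}^m$, and let $S=\{H\pm e_1,\dots,H\pm e_m\}\subseteq \mathbb{Z}^m/H$. The standardized abelian Cayley graph with (associated) Heuberger matrix $M$ is the Cayley graph $\mathrm{Cay}(\mathbb{Z}^m/H,S)$: its vertices are the elements of $\mathbb{Z}^m/H$, and $x,y$ are adjacent if and only if $y-x\in S$. It has loops if and only if $e_j\in H$ for some $j$. $\chi$ denotes the chromatic number (a graph with loops has no proper coloring). A $3\times 2$ integer matrix $M=(y_{ij})$ with no zero row is in modified Hermite normal form if: (1) $y_{11}>0$; (2) $y_{12}=0$; (3) $y_{11}y_{22}\equiv y_{11}y_{32}\pmod 3$; (4) $y_{22}\leq y_{32}$; (5) $|y_{22}|\leq |y_{32}|$; and (6) either (i) $y_{22}=0$ and $-\frac12|y_{32}|\leq y_{31}\leq 0$, or else (ii) $-\frac12|y_{22}|\leq y_{21}\leq 0$. *)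

(* Defs.v *)
From HB Require Import structures.
From mathcomp Require Import all_boot all_order all_algebra ring_quotient.
From mathcomp Require Import boolp.

Set Implicit Arguments.
Unset Strict Implicit.
Unset Printing Implicit Defensive.

Import GRing.Theory Num.Theory.
Local Open Scope ring_scope.
Local Open Scope quotient_scope.

(* Graphs are given by an adjacency relation on a possibly infinite vertex type;
   loops are allowed. *)
Definition proper_coloring (V C : Type) (adj : V -> V -> Prop) (f : V -> C) :=
  forall x y, adj x y -> f x <> f y.

Definition colorable (V : Type) (adj : V -> V -> Prop) (k : nat) :=
  exists f : V -> 'I_k, proper_coloring adj f.

(* A relation rather than a function, since a graph with loops (or, in general,
   an infinite graph) need not have a finite chromatic number. *)
Definition has_chromatic_number (V : Type) (adj : V -> V -> Prop) (k : nat) :=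
  colorable adj k /\ forall l : nat, colorable adj l -> (k <= l)%N.

Definition has_loops (V : Type) (adj : V -> V -> Prop) := exists x, adj x x.

Definition cayley_adj (G : zmodType) (S : G -> Prop) (x y : G) := S (y - x).

Section Heuberger.
Variables (m r : nat) (M : 'M[int]_(m, r)).

(* Membership in H is decided classically so that the library's quotient by a
   (boolean) subgroup applies. *)
Definition column_subgroup : {pred 'cV[int]_m} :=
  fun x => `[< inIntSpan [tuple col j M | j < r] x >].

Lemma column_subgroup_closed : zmod_closed column_subgroup.
Proof.
split; first by apply/asboolP; exists [ffun=> 0]; rewrite big1 // => i _;
  rewrite ffunE mulr0z.
move=> x y /asboolP[a ->] /asboolP[b ->]; apply/asboolP.
exists [ffun i => a i - b i]; rewrite -sumrB; apply: eq_bigr => i _.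
by rewrite ffunE mulrzBr.
Qed.

HB.instance Definition _ :=
  GRing.isZmodClosed.Build 'cV[int]_m column_subgroup column_subgroup_closed.

Definition heuberger_group : zmodType := {ideal_quot column_subgroup}.

Definition heuberger_class (v : 'cV[int]_m) : heuberger_group :=
  \pi_({ideal_quot column_subgroup}) v.

Definition heuberger_connection (x : heuberger_group) : Prop :=
  exists j : 'I_m, x = heuberger_class (delta_mx j 0)
                \/ x = heuberger_class (- delta_mx j 0).

Definition SACG : heuberger_group -> heuberger_group -> Prop :=
  cayley_adj heuberger_connection.

End Heuberger.

Arguments SACG {m r} M x y.

(* Indices are 0-based: the entry y_ij is M (i - 1) (j - 1). *)
Definition mx32 (y11 y12 y21 y22 y31 y32 : int) : 'M[int]_(3, 2) :=
  \matrix_(i < 3, j < 2)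
    nth 0 (nth [::] [:: [:: y11; y12]; [:: y21; y22]; [:: y31; y32]] i) j.

(* The bounds -|y|/2 <= z <= 0 are cleared of denominators. *)
Definition modified_hermite (M : 'M[int]_(3, 2)) : Prop :=
  let y11 := M 0 0 in let y12 := M 0 1 in
  let y21 := M 1 0 in let y22 := M 1 1 in
  let y31 := M 2 0 in let y32 := M 2 1 in
  (forall i, row i M != 0) /\
  [/\ 0 < y11,
      y12 = 0,
      (y11 * y22 = y11 * y32 %[mod 3])%Z,
      y22 <= y32
    & `|y22| <= `|y32| /\
      ((y22 = 0 /\ - `|y32| <= 2 * y31 <= 0)
       \/ (- `|y22| <= 2 * y21 <= 0))].

Definition loop_columns (M : 'M[int]_(3, 2)) : Prop :=
  col 0 M = delta_mx 0 0 \/ col 1 M = delta_mx 2 0.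

Definition even_columns (M : 'M[int]_(3, 2)) : Prop :=
  let y11 := M 0 0 in let y21 := M 1 0 in let y31 := M 2 0 in
  let y22 := M 1 1 in let y32 := M 2 1 in
  (2 %| y11 + y21 + y31)%Z /\ (2 %| y22 + y32)%Z.

Definition six_types (M : 'M[int]_(3, 2)) : Prop :=
  (exists2 k : int, 0 < k &
    M = mx32 1 0
             0 1
             (3 * k) (1 + 3 * k) \/
    M = mx32 1 0
             0 1
             (- (3 * k)) (1 + 3 * k)) \/
  (exists2 k : int, 0 < k &
    M = mx32 1 0
             0 (-1)
             (3 * k) (-1 + 3 * k) \/
    M = mx32 1 0
             0 (-1)
             (- (3 * k)) (-1 + 3 * k)) \/
  (exists2 k : int, 0 < k &
    M = mx32 1 0
             (-1) 2
             (-1 - 3 * k) (2 + 3 * k)) \/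
  (exists2 k : int, 0 < k &
    M = mx32 1 0
             (-1) (-2)
             (-1 + 3 * k) (-2 + 3 * k)) \/
  (exists2 b : int, b != 0 &
    M = mx32 1 0
             0 (-1)
             (3 * b) 2) \/
  (exists a k : int, [/\ ~~ (3 %| a)%Z, 0 < k &
    M = mx32 1 0
             (-1) a
             (-1) (a + 3 * (k - 1))]).

(* Main.v *)
(* A point t of [1/k, 1 - 1/k]^3 whose dot products with both columns are
   integers gives a circular k-colouring: colour x by the arc of length 1/k that
   contains t.x mod 1. For k = 3 write (p, q) and (a, b) for the last two entries
   of the columns. If y11 >= 2, or if y11 = 1 and p, q differ modulo 3, such a t
   is easily found. Otherwise e1 = -(p e2 + q e3), and the points with
   t2 + t3 = 1 suffice unless b - a divides q - p, in which case a column
   operation reduces to p = q = r. For |r| >= 2 moving along t2 + t3 = 1 + eta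
   succeeds except when (a, b) = (-1, 2). For |r| = 1 the graph is a quotient of
   the triangular lattice, whose only 3-colouring is the coordinate sum modulo 3
   and does not descend to the quotient; these cases and (-1, 2), where the graph
   contains Cay(Z, {1, 2, 3k}), are exactly the six types. *)
From HB Require Import structures.
Require Import Defs.
From mathcomp Require Import all_boot all_order all_algebra.
From mathcomp Require Import ring_quotient boolp ring lra zify.

Set Implicit Arguments.
Unset Strict Implicit.
Unset Printing Implicit Defensive.

Import Order.TTheory GRing.Theory Num.Theory.
Local Open Scope ring_scope.
Local Open Scope quotient_scope.

(** * The quotient group and its generators *)

Section HeubergerGroup.
Variables (m r : nat) (M : 'M[int]_(m, r)).

Lemma heuberger_class_is_zmod_morphism :
  zmod_morphism (heuberger_class M).
Proof. by move=> x y; rewrite /heuberger_class raddfB. Qed.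

HB.instance Definition _ := GRing.isZmodMorphism.Build _ _
  (heuberger_class M) heuberger_class_is_zmod_morphism.

Lemma heuberger_class_eq (x y : 'cV[int]_m) :
  heuberger_class M x = heuberger_class M y <-> x - y \in column_subgroup M.
Proof.
rewrite (Quotient.idealrBE (column_subgroup M)).
by split=> [/eqP|/eqP].
Qed.

Lemma heuberger_class_col (j : 'I_r) : heuberger_class M (col j M) = 0.
Proof.
rewrite -(raddf0 (heuberger_class M)); apply/heuberger_class_eq.
rewrite subr0; apply/asboolP; exists [ffun i => (i == j)%:Z].
rewrite (bigD1 j) //= big1 ?addr0 => [|i ij].
  by rewrite ffunE eqxx mulr1z (nth_map j) ?size_enum_ord // nth_ord_enum.
by rewrite ffunE (negPf ij) mulr0z.
Qed.

Lemma sum_column_relation (j : 'I_r) :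
  \sum_i heuberger_class M (delta_mx i 0) *~ M i j = 0.
Proof.
rewrite -[RHS](heuberger_class_col j) [col j M]matrix_sum_delta raddf_sum.
apply: eq_bigr => i _; rewrite big_ord1 mxE.
by rewrite -[X in _ = _ (X *: _)]intz scaler_int raddfMz.
Qed.

Lemma SACG_generator (x : heuberger_group M) (i : 'I_m) :
  SACG M x (x + heuberger_class M (delta_mx i 0)).
Proof. by exists i; left; rewrite addrC addKr. Qed.

Lemma colorable_leq (k l : nat) :
  (k <= l)%N -> colorable (SACG M) k -> colorable (SACG M) l.
Proof.
move=> kl [f fP]; exists (fun x => widen_ord kl (f x)) => x y /fP fxy.
by move/(congr1 val) => /= /val_inj.
Qed.

End HeubergerGroup.

(** * Circular colourings from linear phases *)

Section CircularColoring.
Variables (m r : nat) (M : 'M[int]_(m, r)) (t : 'I_m -> rat).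

Definition phase (v : 'cV[int]_m) : rat := \sum_i t i * (v i 0)%:~R.

Lemma phase_is_zmod_morphism : zmod_morphism phase.
Proof.
move=> x y; rewrite -sumrB; apply: eq_bigr => i _.
by rewrite !mxE rmorphB mulrBr.
Qed.

HB.instance Definition _ := GRing.isZmodMorphism.Build _ _
  phase phase_is_zmod_morphism.

Lemma phase_delta (i : 'I_m) : phase (delta_mx i 0) = t i.
Proof.
rewrite /phase (bigD1 i) //= big1 ?addr0 => [|j ji]; rewrite mxE.
  by rewrite !eqxx mulr1.
by rewrite (negPf ji) mulr0.
Qed.

Hypothesis phase_col : forall j, phase (col j M) \is a Num.int.

(** Integrality on the columns passes to their span, so [phase] is well defined modulo 1 on the
    quotient group. *)
Lemma phase_column_subgroup (v : 'cV[int]_m) :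
  v \in column_subgroup M -> phase v \is a Num.int.
Proof.
move=> /asboolP[a ->]; rewrite raddf_sum rpred_sum // => i _.
rewrite raddfMz rpredMz //.
by rewrite (nth_map i) ?size_enum_ord // nth_ord_enum.
Qed.

(** The circle is cut into k + 1 equal half-open arcs. The scaled fractional part has its floor
    between 0 and k, so neither the absolute value nor the default of [inord] alters it. *)
Definition arc (k : nat) (x : rat) : 'I_k.+1 :=
  inord `|Num.floor (k.+1%:R * (x - (Num.floor x)%:~R))|.

Lemma arc_eq (k : nat) (x y : rat) :
  arc k x = arc k y -> exists n : int, k.+1%:R * `|x - y - n%:~R| < 1.
Proof.
have arc_val (z : rat) : Posz (arc k z) =
    Num.floor (k.+1%:R * (z - (Num.floor z)%:~R)).
  have /andP[z0 z1] := Num.Theory.floor_itv z.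
  have z_ge0 : 0 <= k.+1%:R * (z - (Num.floor z)%:~R).
    by rewrite mulr_ge0 ?ler0n // subr_ge0.
  have fz_ge0 : 0 <= Num.floor (k.+1%:R * (z - (Num.floor z)%:~R)).
    by rewrite Num.Theory.floor_ge0.
  rewrite inordK ?gez0_abs // -ltz_nat gez0_abs // Num.Theory.floor_lt_int.
  rewrite -[ltRHS]mulr1 ltr_pM2l ?ltr0n // ltrBlDl.
  by move: z1; rewrite intrD.
move=> /(congr1 (fun i : 'I__ => Posz i)); rewrite !arc_val => xy.
exists (Num.floor x - Num.floor y).
have := Num.Theory.floor_itv (k.+1%:R * (y - (Num.floor y)%:~R)).
have := Num.Theory.floor_itv (k.+1%:R * (x - (Num.floor x)%:~R)).
rewrite -xy; set u := x - (Num.floor x)%:~R; set v := y - (Num.floor y)%:~R.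
have -> : x - y - (Num.floor x - Num.floor y)%:~R = u - v.
  by rewrite intrD rmorphN /u /v /=; ring.
have -> : k.+1%:R * `|u - v| = `|k.+1%:R * u - k.+1%:R * v|.
  by rewrite -mulrBr normrM normr_nat.
rewrite intrD ltr_norml; move: (_ * u) (_ * v) => {}u {}v.
by move=> /andP[x0 x1] /andP[y0 y1]; lra.
Qed.

(** Along an edge the phase changes by t i or - t i up to an integer, whatever representatives
    [repr] picks. The bounds keep t i at distance at least 1/(k+1) from every integer, whereas two
    points of one arc are closer than that modulo 1. *)
Lemma circular_colorable (k : nat) :
  (forall i, 1 <= k.+1%:R * t i <= k%:R) -> colorable (SACG M) k.+1.
Proof.
move=> t_k; exists (fun X => arc k (phase (repr X))) => X Y adjXY /arc_eq[n].
have [i [s [s_sign /intrP[l XY]]]] : exists i s, (s = 1 \/ s = -1 :> rat) /\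
    phase (repr X) - phase (repr Y) - s * t i \is a Num.int.
  have repr_class Z : Z = heuberger_class M (repr Z) by rewrite -[LHS]reprK.
  have [i XY] := adjXY; exists i.
  have phase_diff v : Y - X = heuberger_class M v ->
      phase (repr X) - phase (repr Y) + phase v \is a Num.int.
    rewrite {1}[X]repr_class {1}[Y]repr_class -raddfB => /heuberger_class_eq.
    move=> /phase_column_subgroup; rewrite -rpredN !raddfB /=.
    by congr (_ \is a Num.int); ring.
  case: XY => /phase_diff; rewrite ?raddfN /= phase_delta => int_XY.
    by exists (-1); split; [right|rewrite mulN1r opprK].
  by exists 1; split; [left|rewrite mul1r].
have -> : phase (repr X) - phase (repr Y) - n%:~R = s * t i + (l - n)%:~R.
  by rewrite intrD rmorphN /= -XY; ring.
have /andP[] := t_k i; set K : rat := k.+1%:R => K1 K2.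
have K_ge0 : 0 <= K by rewrite ler0n.
have Kk : K = k%:R + 1 by rewrite /K -natr1.
have {s_sign} : s * t i = t i \/ s * t i = - t i.
  by case: s_sign => ->; [left; rewrite mul1r|right; rewrite mulN1r].
rewrite -(ger0_norm K_ge0) -normrM mulrDr ltr_norml.
have far (e : int) : 1 <= K * t i + K * e%:~R \/ K * t i + K * e%:~R <= -1.
  have [e0|e0] := lerP 0 e; [left|right].
    have : 0 <= K * e%:~R by rewrite mulr_ge0 // ler0z.
    lra.
  have : K * e%:~R <= K * (-1)%:~R by rewrite ler_wpM2l // ler_int; lia.
  by rewrite mulrN1z mulrN1; lra.
case=> -> /andP[lo hi]; first by case: (far (l - n)); lra.
by case: (far (n - l)); rewrite -[n - l]opprB rmorphN mulrN; lra.
Qed.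

End CircularColoring.

(** * Integer values of affine maps, and the point condition for three rows *)

Lemma interval_has_int (x y : rat) : 1 <= y - x ->
  exists n : int, x <= n%:~R <= y.
Proof.
move=> xy; exists (Num.floor y); have := Num.Theory.floor_itv y.
by rewrite intrD => /andP[y0 y1]; lra.
Qed.

Lemma intr_divz (d z : int) : (d %| z)%Z ->
  z%:~R = (z %/ d)%Z%:~R * d%:~R :> rat.
Proof. by move=> dz; rewrite -intrM divzK. Qed.

(** The affine map stretches [lo, hi] to length at least 1, so its image contains an integer. *)
Lemma affine_hits_int (c : int) (x lo hi : rat) :
  1 <= `|c|%:~R * (hi - lo) ->
  exists (t : rat) (n : int), lo <= t <= hi /\ c%:~R * t + x = n%:~R.
Proof.
wlog c_ge0 : c x / 0 <= c => [wlog_c|].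
  have [/wlog_c|c_lt0] := lerP 0 c; first exact.
  rewrite -normrN => /wlog_c-/(_ (- x)); case; first lia.
  move=> t [n [t_in eq_n]]; exists t, (- n); split=> //.
  by move: eq_n; rewrite !rmorphN /=; lra.
rewrite ger0_norm // => c_len.
have c_neq0 : c%:~R != 0 :> rat.
  by apply/eqP => c0; move: c_len; rewrite c0 mul0r; lra.
have c_gt0 : 0 < c%:~R :> rat by rewrite lt_def c_neq0 ler0z.
have [|n /andP[n_lo n_hi]] := @interval_has_int (c%:~R * lo + x) (c%:~R * hi + x).
  by lra.
exists ((n%:~R - x) / c%:~R), n; split; last by field.
by rewrite ler_pdivlMr // ler_pdivrMr //; lra.
Qed.

Definition arc_point (k : nat) (t : rat) := 1 <= k.+1%:R * t <= k%:R.

(** The index k stands for k + 1 colours. The second equation has no t1 term because y12 = 0. *)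
Definition circular (k : nat) (y11 y21 y31 y22 y32 : int) :=
  exists (t1 t2 t3 : rat) (n1 n2 : int),
  [/\ arc_point k t1, arc_point k t2, arc_point k t3,
      y11%:~R * t1 + y21%:~R * t2 + y31%:~R * t3 = n1%:~R
    & y22%:~R * t2 + y32%:~R * t3 = n2%:~R].

Lemma circular_SACG_colorable (k : nat) (M : 'M[int]_(3, 2)) : M 0 1 = 0 ->
  circular k (M 0 0) (M 1 0) (M 2 0) (M 1 1) (M 2 1) ->
  colorable (SACG M) k.+1.
Proof.
move=> M01 [t1 [t2 [t3 [n1 [n2 [t1k t2k t3k eq1 eq2]]]]]].
pose t (i : 'I_3) := nth 0 [:: t1; t2; t3] i.
apply: (@circular_colorable _ _ M t).
  move=> j; rewrite /phase !big_ord_recl big_ord0 !mxE /= addr0.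
  case: j => [[|[|//]] j_lt] /=; rewrite /t /=.
    have -> : Ordinal j_lt = 0 by apply: val_inj.
    apply/intrP; exists n1; rewrite -eq1 !(mulrC _%:~R) addrA.
    by congr (_ + _ * (M _ _)%:~R + _ * (M _ _)%:~R); apply: val_inj.
  have -> : Ordinal j_lt = 1 by apply: val_inj.
  apply/intrP; exists n2; rewrite -eq2 M01 mulr0 add0r !(mulrC _%:~R).
  by congr (_ * (M _ _)%:~R + _ * (M _ _)%:~R); apply: val_inj.
by case=> [[|[|[|//]]] i_lt].
Qed.

(** The same point works: its product with the first column changes by l times an integer. *)
Lemma circular_column_op (k : nat) (y11 y21 y31 y22 y32 l : int) :
  circular k y11 y21 y31 y22 y32 ->
  circular k y11 (y21 + l * y22) (y31 + l * y32) y22 y32.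
Proof.
move=> [t1 [t2 [t3 [n1 [n2 [t1k t2k t3k eq1 eq2]]]]]].
exists t1, t2, t3, (n1 + l * n2), n2; split=> //.
by rewrite !(intrD, intrM) -eq1 -eq2; ring.
Qed.

(** * Three colours when y11 is at least 2 *)

Lemma circular_pivot_ge3 (y11 y21 y31 y22 y32 : int) :
  3 <= y11 -> y22 <= y32 -> `|y22| <= `|y32| -> y32 != 0 ->
  ~ (y22 = 0 /\ y32 = 1) -> circular 2 y11 y21 y31 y22 y32.
Proof.
move=> y11_ge3 le_y abs_y y32_neq0 no_loop.
(* Only the second equation matters here: since y11 >= 3, the range of t1, of length 1/3, suffices
   to solve the first one afterwards. *)
have [t2 [t3 [n2 [t2k t3k eq2]]]] : exists (t2 t3 : rat) (n2 : int),
    [/\ arc_point 2 t2, arc_point 2 t3 & y22%:~R * t2 + y32%:~R * t3 = n2%:~R].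
  have [y32_ge3|y32_lt3] := lerP 3 `|y32|.
    have [|t3 [n [t3k eq]]] := @affine_hits_int y32 (y22%:~R / 2) (1 / 3) (2 / 3).
      by have : 3%:~R <= `|y32|%:~R :> rat; [rewrite ler_int|lra].
    exists (1 / 2), t3, n; rewrite /arc_point; split; last by rewrite -eq; lra.
      by lra.
    by lra.
  have [half|not_half] := boolP (~~ odd `|y22 + y32|).
    exists (1 / 2), (1 / 2), ((y22 + y32) %/ 2)%Z; rewrite /arc_point.
    split; [lra|lra|].
    have -> : y22%:~R * (1 / 2) + y32%:~R * (1 / 2)
        = (y22 + y32)%:~R / 2 :> rat by rewrite intrD; lra.
    have {1}-> : y22 + y32 = ((y22 + y32) %/ 2)%Z * 2 by lia.
    by rewrite intrM; lra.
  (* The sum y22 + y32 is odd. A negative y32 would force y22 = y32, and y32 = 1 would force y22 =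
     0, the excluded loop. *)
  have y32_2 : y32 = 2 by lia.
  have [->|->] : y22 = 1 \/ y22 = -1 by lia.
    by exists (1 / 3), (1 / 3), 1; rewrite /arc_point y32_2; split; lra.
  by exists (2 / 3), (1 / 3), 0; rewrite /arc_point y32_2; split; lra.
have [|t1 [n [t1k eq]]] :=
    @affine_hits_int y11 (y21%:~R * t2 + y31%:~R * t3) (1 / 3) (2 / 3).
  have : 3%:~R <= `|y11|%:~R :> rat; last by lra.
  by rewrite ler_int; lia.
exists t1, t2, t3, n, n2; split=> //; last by rewrite -eq; lra.
by rewrite /arc_point; lra.
Qed.

(* The point (1/3, 2/3) works in the last two coordinates since
   y22 = y32 mod 3. *)
Lemma circular_pivot2 (y21 y31 y22 n : int) :
  circular 2 2 y21 y31 y22 (y22 + 3 * n).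
Proof.
have eq2 : y22%:~R * (1 / 3) + (y22 + 3 * n)%:~R * (2 / 3)
    = (y22 + 2 * n)%:~R :> rat by rewrite !(intrD, intrM); lra.
set s := y21 + 2 * y31.
have sE : y21%:~R * (1 / 3) + y31%:~R * (2 / 3) =
    (s %/ 3)%Z%:~R + (s %% 3)%Z%:~R / 3 :> rat.
  have : s%:~R = (s %/ 3)%Z%:~R * 3 + (s %% 3)%Z%:~R :> rat.
    by rewrite {1}(divz_eq s 3) intrD intrM.
  by rewrite /s !(intrD, intrM); lra.
have [t1 [m [t1k t1E]]] : exists (t1 : rat) (m : int),
    arc_point 2 t1 /\ 2%:~R * t1 + (s %% 3)%Z%:~R / 3 = m%:~R.
  have [s0|[s1|s2]] : (s %% 3)%Z = 0 \/ (s %% 3)%Z = 1 \/ (s %% 3)%Z = 2 by lia.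
  - by exists (1 / 2), 1; rewrite /arc_point s0; split; lra.
  - by exists (1 / 3), 1; rewrite /arc_point s1; split; lra.
  - by exists (2 / 3), 2; rewrite /arc_point s2; split; lra.
exists t1, (1 / 3), (2 / 3), ((s %/ 3)%Z + m), (y22 + 2 * n).
by rewrite /arc_point; split=> //; rewrite intrD; lra.
Qed.

(** * Three colours when y11 = 1 *)

Lemma circular_thirds (p q a b i j : int) :
  1 <= i <= 2 -> 1 <= j <= 2 -> ~~ (3 %| p * i + q * j)%Z ->
  (3 %| a * i + b * j)%Z -> circular 2 1 p q a b.
Proof.
move=> i_12 j_12 pq_n3 ab_3.
set s := p * i + q * j; have s3 := divz_eq s 3.
(* With t2 = i/3 and t3 = j/3 the first equation forces t1 = -s/3 modulo 1, which is 1/3 or 2/3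
   because 3 does not divide s. *)
exists (1 - (s %% 3)%Z%:~R / 3), (i%:~R / 3), (j%:~R / 3),
  (1 + (s %/ 3)%Z), ((a * i + b * j) %/ 3)%Z.
have thirds (l : int) : 1 <= l <= 2 -> 1 <= (l%:~R : rat) <= 2.
  by rewrite (ler_int rat 1 l) (ler_int rat l 2).
have s_12 : 1 <= (s %% 3)%Z <= 2 by lia.
have := thirds _ i_12; have := thirds _ j_12; have := thirds _ s_12.
rewrite /arc_point => /andP[? ?] /andP[? ?] /andP[? ?]; split; try lra.
  have : p%:~R * i%:~R + q%:~R * j%:~R =
     (s %/ 3)%Z%:~R * 3 + (s %% 3)%Z%:~R :> rat.
    by rewrite -!intrM -intrD -/s {1}s3 intrD intrM.
  rewrite !(intrD, intrM); lra.
have : a%:~R * i%:~R + b%:~R * j%:~R = ((a * i + b * j) %/ 3)%Z%:~R * 3 :> rat.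
  by rewrite -!intrM -intrD -{1}(divzK ab_3) intrM.
by lra.
Qed.

(** Take the least positive j with 3jc >= n. If j = 1 the upper bound is the hypothesis; otherwise
    3c <= 3(j-1)c < n, and one more step stays below 2n. *)
Lemma multiple_in_middle_third (n c : int) : 0 < c -> 3 * c <= 2 * n ->
  exists j : int, [/\ 0 < j, n <= 3 * (j * c) <= 2 * n & 3 * ((j - 1) * c) < n].
Proof.
move=> c_gt0 cn; set j := ((n - 1) %/ (3 * c))%Z.
have jE := divz_eq (n - 1) (3 * c); rewrite -/j in jE.
have r_ge0 := modz_ge0 (n - 1) (_ : 3 * c != 0).
have r_lt := ltz_pmod (n - 1) (_ : 0 < 3 * c).
have {}r_ge0 := r_ge0 ltac:(lia); have {}r_lt := r_lt ltac:(lia).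
have j_ge0 : 0 <= j by rewrite divz_ge0; lia.
have jcE : 3 * (j * c) = j * (3 * c) by ring.
exists (j + 1); rewrite addrK mulrDl mul1r; split; try lia.
have [j0|j_gt0] : j = 0 \/ 0 < j by lia.
  by move: jE; rewrite j0 mul0r; lia.
have : 3 * c <= j * (3 * c) by rewrite ler_peMl; lia.
by lia.
Qed.

(** Multiples of the residue r of c reach the middle third if 3r <= 2n; otherwise multiples of n - r
    do, with a negative multiplier. The multiplier matters only modulo n, so it can be moved into
    [n, 2n], which will put k/(3n) in [1/3, 2/3]. *)
Lemma multiple_mod_middle_third (n c : int) : 0 < n -> ~~ (n %| c)%Z ->
  exists k m s : int,
    [/\ n <= k <= 2 * n, k * c = m * n + s & n <= 3 * s <= 2 * n].
Proof.
move=> n_gt0 nc; have cE := divz_eq c n; set r := (c %% n)%Z in cE.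
have r_ge0 : 0 <= r by rewrite modz_ge0; lia.
have r_lt : r < n by rewrite ltz_pmod.
have r_neq0 : r != 0 by apply: contra nc => /eqP/dvdz_mod0P.
have [k [m [s [kE sE]]]] : exists k m s : int,
    k * c = m * n + s /\ n <= 3 * s <= 2 * n.
  have [rn|rn] := lerP (3 * r) (2 * n).
    have [|j [_ j_n _]] := multiple_in_middle_third _ rn; first lia.
    exists j, (j * (c %/ n)%Z), (j * r); split=> //.
    by rewrite {1}cE; ring.
  have [||j [_ j_n _]] := @multiple_in_middle_third n (n - r); try lia.
  exists (- j), (- j * (c %/ n)%Z - j), (j * (n - r)); split=> //.
  by rewrite {1}cE; ring.
have k_ge0 : 0 <= (k %% n)%Z by rewrite modz_ge0; lia.
have k_lt : (k %% n)%Z < n by rewrite ltz_pmod.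
exists ((k %% n)%Z + n), (m + (1 - (k %/ n)%Z) * c), s; split=> //; first lia.
have -> : (k %% n)%Z = k - (k %/ n)%Z * n by rewrite {2}(divz_eq k n); ring.
have -> : (k - (k %/ n)%Z * n + n) * c = k * c + (1 - (k %/ n)%Z) * c * n by ring.
by rewrite kE; ring.
Qed.

(* On the antidiagonal t2 + t3 = 1 both congruences modulo 3 cancel, which leaves
   a condition modulo n with a free choice of the multiplier. *)
Lemma circular_antidiagonal (p a n c : int) : 0 <= n -> ~~ (n %| c)%Z ->
  circular 2 1 p (p + 3 * c) a (a + 3 * n).
Proof.
move=> n_ge0 nc; have [n0|n_gt0] : n = 0 \/ 0 < n by lia.
  have c_neq0 : c != 0 by move: nc; rewrite n0 dvd0z.
  have [|t [l [t_in eq_l]]] :=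
      @affine_hits_int (3 * c) (p%:~R + 1 / 2) (1 / 3) (2 / 3).
    have : 3%:~R <= `|3 * c|%:~R :> rat; last by lra.
    by rewrite ler_int; lia.
  exists (1 / 2), (1 - t), t, l, a.
  rewrite /arc_point n0 mulr0 addr0; split; [lra|lra|lra| |lra].
  by move: eq_l; rewrite !(intrD, intrM); lra.
have [k [m [s [k_in kE s_in]]]] := multiple_mod_middle_third n_gt0 nc.
have n_rat : 0 < n%:~R :> rat by rewrite ltr0z.
have n_neq0 : n%:~R != 0 :> rat by rewrite lt0r_neq0.
have [s_lo s_hi] : 1 / 3 <= s%:~R / n%:~R :> rat /\ s%:~R / n%:~R <= 2 / 3 :> rat.
  rewrite (ler_pdivlMr _ _ n_rat) (ler_pdivrMr _ _ n_rat).
  have : n%:~R <= (3 * s)%:~R :> rat by rewrite ler_int; lia.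
  have : (3 * s)%:~R <= (2 * n)%:~R :> rat by rewrite ler_int; lia.
  by rewrite !intrM; split; lra.
have [k_lo k_hi] : 1 <= k%:~R / n%:~R :> rat /\ k%:~R / n%:~R <= 2 :> rat.
  rewrite (ler_pdivlMr _ _ n_rat) (ler_pdivrMr _ _ n_rat).
  have : n%:~R <= k%:~R :> rat by rewrite ler_int; lia.
  have : k%:~R <= (2 * n)%:~R :> rat by rewrite ler_int; lia.
  by rewrite !intrM; split; lra.
exists (1 - s%:~R / n%:~R), (1 - k%:~R / n%:~R / 3), (k%:~R / n%:~R / 3),
  (1 + p + m), (a + k).
rewrite /arc_point; split; [lra|lra|lra| |].
  have : k%:~R * c%:~R = m%:~R * n%:~R + s%:~R :> rat.
    by rewrite -!intrM -intrD kE.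
  rewrite !(intrD, intrM) => kcE.
  have -> : m%:~R = (k%:~R * c%:~R - s%:~R) / n%:~R :> rat.
    by rewrite kcE; field; exact: n_neq0.
  field; exact: n_neq0.
rewrite !(intrD, intrM); field; exact: n_neq0.
Qed.

Lemma arc_point_opp (x : rat) : 1 <= 3 * `|x| <= 2 ->
  exists (t : rat) (n : int), arc_point 2 t /\ t + x = n%:~R.
Proof.
move=> x_in; have [x_ge0|x_lt0] := lerP 0 x.
  exists (1 - x), 1; rewrite /arc_point addrNK; split=> //.
  by move: x_in; rewrite ger0_norm //; lra.
exists (- x), 0; rewrite /arc_point addNr; split=> //.
by move: x_in; rewrite ltr0_norm.
Qed.

(** Take t2 = t3 = (1 + eta)/2 with eta = j/a, so the second product is a + j. Then t1 = -p eta
    modulo 1 is admissible once j|p| lies in the middle third of |a|, and |eta| <= 1/3 keeps t2 and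
    t3 admissible. *)
Lemma circular_equal (p a : int) : 2 <= `|p| -> 2 * `|p| <= `|a| ->
  circular 2 1 p p a a.
Proof.
move=> p_ge2 pa; have [||j [j_gt0 j_in j_lt]] :=
  @multiple_in_middle_third `|a| `|p|; try lia.
(* For j >= 2 the minimality of j gives 6(j-1) <= 3(j-1)|p| < |a|, and 3j <= 6(j-1). *)
have j_le : 3 * j <= `|a|.
  have [->|j_ge2] : j = 1 \/ 2 <= j by lia.
    by lia.
  have : (j - 1) * 2 <= (j - 1) * `|p| by rewrite ler_wpM2l; lia.
  by lia.
have a_neq0 : a%:~R != 0 :> rat by rewrite intr_eq0; lia.
set eta : rat := j%:~R / a%:~R.
have eta_norm : `|eta| * `|a|%:~R = j%:~R.
  by rewrite intr_norm -normrM divfK // ger0_norm // ler0z; lia.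
have a_gt0 : 0 < `|a|%:~R :> rat by rewrite ltr0z; lia.
have /ler_normlP[eta_lo eta_hi] : `|eta| <= 1 / 3.
  rewrite -(ler_pM2r a_gt0) eta_norm.
  have : (3 * j)%:~R <= `|a|%:~R :> rat by rewrite ler_int; lia.
  by rewrite intrM; lra.
have [|t1 [n [t1k t1E]]] := @arc_point_opp (p%:~R * eta).
  have p_eta : `|p%:~R * eta| * `|a|%:~R = `|p|%:~R * j%:~R.
    by rewrite normrM -mulrA eta_norm -intr_norm.
  have lo : `|a|%:~R <= (3 * (j * `|p|))%:~R :> rat by rewrite ler_int; lia.
  have hi : (3 * (j * `|p|))%:~R <= (2 * `|a|)%:~R :> rat by rewrite ler_int; lia.
  move: lo hi; rewrite !intrM => lo hi.
  by apply/andP; split; rewrite -(ler_pM2r a_gt0); lra.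
exists t1, ((1 + eta) / 2), ((1 + eta) / 2), (n + p), (a + j).
rewrite /arc_point; split=> //; [lra|lra| |].
  by rewrite intrD -t1E; field.
rewrite intrD /eta; field; exact: a_neq0.
Qed.

(* Writing t2 + t3 = 1 + eta, the point t3 is free in [1/3 + eta, 2/3]. *)
Lemma circular_diagonal (r a n j : int) (eta : rat) :
  0 < n -> 0 <= eta -> 1 <= 3 * (`|r|%:~R * eta) <= 2 ->
  (a + 3 * n)%:~R * eta <= (j - n)%:~R -> j%:~R <= n%:~R * 2 + a%:~R * eta ->
  circular 2 1 r r a (a + 3 * n).
Proof.
move=> n_gt0 eta_ge0 r_eta; rewrite !(intrD, intrM) => lo hi.
have n_rat : 0 < n%:~R :> rat by rewrite ltr0z.
have n_neq0 : n%:~R != 0 :> rat by rewrite lt0r_neq0.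
have [|t1 [m [t1k t1E]]] := @arc_point_opp (r%:~R * eta).
  by rewrite normrM (ger0_norm eta_ge0) -intr_norm.
(* This solves a(1 + eta) + 3n t3 = a + j; the two bounds on j say exactly that 1/3 + eta <= t3 <=
   2/3. *)
set t3 : rat := (j%:~R - a%:~R * eta) / n%:~R / 3.
have t3E : n%:~R * t3 * 3 = j%:~R - a%:~R * eta by rewrite /t3; field.
have t3_lo : n%:~R * (1 + 3 * eta) <= n%:~R * (3 * t3) by lra.
have t3_hi : n%:~R * (3 * t3) <= n%:~R * 2 by lra.
rewrite !(ler_pM2l n_rat) in t3_lo t3_hi.
exists t1, (1 + eta - t3), t3, (m + r), (a + j).
rewrite /arc_point; split=> //; [lra|lra| |].
  by rewrite intrD -t1E; ring.
by rewrite !(intrD, intrM); lra.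
Qed.

(** With eta = 1/(3|r|) <= 1/6 the interval allowed for j has length n(1 - 3 eta) >= n/2 >= 1. *)
Lemma circular_diagonal_ge2 (r a n : int) : 2 <= `|r| -> 2 <= n ->
  circular 2 1 r r a (a + 3 * n).
Proof.
move=> r_ge2 n_ge2.
have r_rat : 2%:~R <= `|r|%:~R :> rat by rewrite ler_int.
have r_neq0 : `|r|%:~R != 0 :> rat by apply: lt0r_neq0; lra.
set eta : rat := (3 * `|r|%:~R)^-1.
have r_eta : `|r|%:~R * eta = 1 / 3 by rewrite /eta; field.
have eta_ge0 : 0 <= eta by rewrite invr_ge0; lra.
have eta_le : 2%:~R * eta <= `|r|%:~R * eta by rewrite ler_wpM2r.
have n_rat : 2%:~R <= n%:~R :> rat by rewrite ler_int.
have n_eta : n%:~R * eta <= n%:~R * (1 / 6).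
  by apply: ler_wpM2l; lra.
have [|j /andP[j_lo j_hi]] :=
    @interval_has_int (n%:~R + (a + 3 * n)%:~R * eta) (n%:~R * 2 + a%:~R * eta).
  by rewrite !(intrD, intrM); lra.
apply: (@circular_diagonal _ _ _ j eta) => //; first lia.
  by rewrite r_eta; lra.
by move: j_lo; rewrite !(intrD, intrM, rmorphN) /=; lra.
Qed.

(** For n = 1 and eta > 0 the interval for the integer is shorter than 1, so eta is fitted to it.
    For large |r|, eta = 1/(3|r|) admits the integer 2. Otherwise eta = j/(a+3) makes the lower end
    the integer j + 1, and 3 eta <= 1 puts it below the upper end. *)
Lemma circular_diagonal1 (r a : int) : 2 <= `|r| -> 1 <= a ->
  circular 2 1 r r a (a + 3).
Proof.
move=> r_ge2 a_ge1; rewrite -[3]/(3 * 1 : int).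
have [br|rb] := lerP (3 * `|r|) (2 * (a + 3)); last first.
  have r_rat : 2%:~R <= `|r|%:~R :> rat by rewrite ler_int.
  have r_neq0 : `|r|%:~R != 0 :> rat by apply: lt0r_neq0; lra.
  have r_gt0 : 0 < 3 * `|r|%:~R :> rat by lra.
  set eta : rat := (3 * `|r|%:~R)^-1.
  have r_eta : `|r|%:~R * eta = 1 / 3 by rewrite /eta; field.
  have eta_ge0 : 0 <= eta by rewrite invr_ge0; lra.
  apply: (@circular_diagonal _ _ _ 2 eta) => //; first by rewrite r_eta; lra.
    rewrite mulr1 /eta ler_pdivrMr // mul1r.
    have : (a + 3)%:~R <= (3 * `|r|)%:~R :> rat by rewrite ler_int; lia.
    by rewrite intrM.
  have : 0 <= a%:~R * eta by rewrite mulr_ge0 // ler0z; lia.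
  by lra.
have [|j [j_gt0 j_in j_lt]] := @multiple_in_middle_third (a + 3) `|r| _ br.
  by lia.
have j_le : 3 * j <= a + 3.
  have [->|j_ge2] : j = 1 \/ 2 <= j by lia.
    by lia.
  have : (j - 1) * 2 <= (j - 1) * `|r| by rewrite ler_wpM2l; lia.
  by lia.
have b_gt0 : 0 < (a + 3)%:~R :> rat by rewrite ltr0z; lia.
have b_neq0 : (a + 3)%:~R != 0 :> rat by rewrite lt0r_neq0.
set eta : rat := j%:~R / (a + 3)%:~R.
have etaE : (a + 3)%:~R * eta = j%:~R by rewrite /eta mulrC divfK.
have eta_le : 3 * eta <= 1.
  rewrite -(ler_pM2l b_gt0) mulrCA etaE mulr1.
  by have : (3 * j)%:~R <= (a + 3)%:~R :> rat; [rewrite ler_int|rewrite intrM].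
apply: (@circular_diagonal _ _ _ (j + 1) eta) => //.
- by rewrite divr_ge0 // ler0z; lia.
- have r_eta : (a + 3)%:~R * (`|r|%:~R * eta) = `|r|%:~R * j%:~R.
    by rewrite mulrCA etaE.
  have lo : (a + 3)%:~R <= (3 * (j * `|r|))%:~R :> rat by rewrite ler_int; lia.
  have hi : (3 * (j * `|r|))%:~R <= (2 * (a + 3))%:~R :> rat.
    by rewrite ler_int; lia.
  rewrite !(intrM _ 3) !(intrM _ 2) !(intrM _ j) in lo hi.
  by apply/andP; split; rewrite -(ler_pM2l b_gt0); lra.
- by rewrite mulr1 etaE addrK.
- by move: etaE; rewrite !intrD; lra.
Qed.

(** * Four colours for the six types *)

Lemma circular_diagonal4 (r a b : int) : `|r| = 1 ->
  4 <= `|b| \/ a = b /\ `|a| = 2 -> circular 3 1 r r a b.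
Proof.
move=> r1 ab.
(* As r is 1 or -1, t1 is t2 + t3 up to sign modulo 1, so t2 + t3 must lie in [1/4, 3/4]. *)
have [t2 [t3 [n2 [t2k t3k sum_le eq2]]]] : exists (t2 t3 : rat) (n2 : int),
    [/\ 1 / 4 <= t2, 1 / 4 <= t3, t2 + t3 <= 3 / 4
      & a%:~R * t2 + b%:~R * t3 = n2%:~R].
  case: ab => [b_ge4|[<- a2]].
    have [|t [n [t_in tE]]] := @affine_hits_int b (a%:~R / 4) (1 / 4) (1 / 2).
      by have : 4%:~R <= `|b|%:~R :> rat; [rewrite ler_int|lra].
    by exists (1 / 4), t, n; split; lra.
  have [->|->] : a = 2 \/ a = -2 by lia.
    by exists (1 / 4), (1 / 4), 1; split; lra.
  by exists (1 / 4), (1 / 4), (-1); split; lra.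
have [->|->] : r = 1 \/ r = -1 by lia.
  by exists (1 - (t2 + t3)), t2, t3, 1, n2; rewrite /arc_point; split; lra.
by exists (t2 + t3), t2, t3, 0, n2; rewrite /arc_point; split; lra.
Qed.

(** Setting t2 = 2 t3 makes the second product vanish, and t3 may range over [1/4, 3/8]. This length
    1/8 is enough for |3k| >= 9; smaller k get explicit points. *)
Lemma circular4_type5 (k : int) : k != 0 -> circular 3 1 0 (3 * k) (-1) 2.
Proof.
move=> k_neq0.
have [t1 [t [n [t1k t_in tE]]]] : exists (t1 t : rat) (n : int),
    [/\ arc_point 3 t1, 1 / 4 <= t <= 3 / 8 & t1 + (3 * k)%:~R * t = n%:~R].
  have [k_ge3|k_lt3] := lerP 3 `|k|.
    have [|t [n [t_in tE]]] := @affine_hits_int (3 * k) (1 / 2) (1 / 4) (3 / 8).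
      have : 9%:~R <= `|3 * k|%:~R :> rat; last by lra.
      by rewrite ler_int; lia.
    by exists (1 / 2), t, n; rewrite /arc_point; split; lra.
  have [->|[->|[->|->]]] : k = 1 \/ k = -1 \/ k = 2 \/ k = -2 by lia.
  - by exists (1 / 4), (1 / 4), 1.
  - by exists (3 / 4), (1 / 4), 0.
  - by exists (1 / 2), (1 / 4), 2.
  - by exists (1 / 2), (1 / 4), (-1).
exists t1, (2 * t), t, n, 0; move: t1k.
by rewrite /arc_point => t1k; split; lra.
Qed.

(** * Rigidity of colourings under translation *)

Section TranslationColoring.
Variables (G : zmodType) (C : Type) (f : G -> C).

Lemma period_mulrz (g : G) : (forall x, f (x + g) = f x) ->
  forall (n : int) x, f (x + g *~ n) = f x.
Proof.
move=> fg; elim=> [|n IHn|n IHn] x; first by rewrite mulr0z addr0.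
  by rewrite intS mulrzDr mulr1z addrA IHn.
rewrite -[in RHS](subrK g x) fg -[RHS](IHn).
by rewrite -addrA -{2}[g]mulr1z -mulrNz -mulrzDr intS opprD.
Qed.

End TranslationColoring.

Lemma two_colors (x y z : 'I_2) : x <> y -> z <> y -> x = z.
Proof.
move=> /eqP xy /eqP zy; apply/val_inj; move: xy zy; rewrite -!val_eqE /=.
by have := ltn_ord x; have := ltn_ord y; have := ltn_ord z; lia.
Qed.

Lemma three_colors (x y z w : 'I_3) :
  x <> y -> z <> x -> z <> y -> w <> x -> w <> y -> z = w.
Proof.
move=> /eqP xy /eqP zx /eqP zy /eqP wx /eqP wy; apply/val_inj.
move: xy zx zy wx wy; rewrite -!val_eqE /=.
have := ltn_ord x; have := ltn_ord y; have := ltn_ord z; have := ltn_ord w.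
by lia.
Qed.

(** The points x + u and x + 2u have distinct colours, and both x and x + 3u must take the third
    one. *)
Lemma three_coloring_period (G : zmodType) (f : G -> 'I_3) (u : G) :
  (forall x, f (x + u) <> f x) -> (forall x, f (x + u *+ 2) <> f x) ->
  forall x, f (x + u *+ 3) = f x.
Proof.
move=> fu fu2 x; apply: (@three_colors (f (x + u)) (f (x + u *+ 2))).
- by move=> e; apply: (fu (x + u)); rewrite e mulr2n addrA.
- by move=> e; apply: (fu2 (x + u)); rewrite -e -addrA -mulrS.
- by move=> e; apply: (fu (x + u *+ 2)); rewrite -e -addrA -mulrSr.
- by move=> e; apply: (fu x).
- by move=> e; apply: (fu2 x).
Qed.

(* The 3-colouring of a triangular lattice is unique: it is invariant under
   v - u and 3 u, so it depends only on the coordinate sum modulo 3. *)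
Lemma triangular_not_three_colorable (G : zmodType) (f : G -> 'I_3) (u v : G)
    (a b : int) :
  (forall x, f (x + u) <> f x) -> (forall x, f (x + v) <> f x) ->
  (forall x, f (x + (u + v)) <> f x) ->
  u *~ a + v *~ b = 0 -> (3 %| a + b)%Z.
Proof.
move=> fu fv fw rel.
(* Both points must avoid the colours of x and x + (u + v), which are distinct. *)
have swap x : f (x + v) = f (x + u).
  apply: (@three_colors (f x) (f (x + (u + v)))) => //.
  - by move=> e; apply: (fw x).
  - by move=> e; apply: (fu (x + v)); rewrite -addrA (addrC v u).
  - by move=> e; apply: (fv (x + u)); rewrite -addrA.
have fvu x : f (x + (v - u)) = f x.
  by rewrite addrA addrAC swap subrK.
have fu2 x : f (x + u *+ 2) <> f x.
  by rewrite mulr2n addrA -swap -addrA; apply: fw.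
have fu3 := three_coloring_period fu fu2.
have relE : u *~ ((a + b) %% 3)%Z + (u *+ 3) *~ ((a + b) %/ 3)%Z
    + (v - u) *~ b = 0.
  rewrite -rel pmulrn -mulrzA -mulrzDr mulrzBl.
  have -> : ((a + b) %% 3)%Z + 3%:Z * ((a + b) %/ 3)%Z = a + b.
    by rewrite [RHS](divz_eq _ 3); ring.
  rewrite mulrzDr -addrA; congr (_ + _); by rewrite addrC subrK.
have : f (u *~ ((a + b) %% 3)%Z) = f 0.
  by rewrite -[in RHS]relE (period_mulrz fvu) (period_mulrz fu3).
have [/dvdz_mod0P //|[->|->]] : ((a + b) %% 3)%Z = 0 \/
    ((a + b) %% 3)%Z = 1 \/ ((a + b) %% 3)%Z = 2 by lia.
  by rewrite mulr1z => e; case: (fu 0); rewrite add0r.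
by rewrite -pmulrn => e; case: (fu2 0); rewrite add0r.
Qed.

(** * Lower bounds from the two column relations *)

Section ThreeRows.
Variable M : 'M[int]_(3, 2).
Local Notation g i := (heuberger_class M (delta_mx i 0)).

Lemma column_relation (j : 'I_2) :
  g 0 *~ M 0 j + g 1 *~ M 1 j + g 2 *~ M 2 j = 0.
Proof.
rewrite -[RHS](sum_column_relation M j) !big_ord_recl big_ord0 addr0 addrA.
by congr (_ + g _ *~ M _ j + g _ *~ M _ j); apply: val_inj.
Qed.

Lemma proper_coloring_generator (C : Type) (f : heuberger_group M -> C) :
  proper_coloring (SACG M) f -> forall i x, f (x + g i) <> f x.
Proof. by move=> fP i x e; apply: (fP _ _ (SACG_generator x i)). Qed.

(** Each generator flips the colour, so a 2-colouring is invariant under 2 [g 0] and each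
    [g i - g 0]. It sees only the parity of the coordinate sum, which must be even on every
    relation. *)
Lemma colorable2_even : colorable (SACG M) 2 ->
  (2 %| (M 0 0 + M 1 0 + M 2 0)%R)%Z /\ (2 %| (M 0 1 + M 1 1 + M 2 1)%R)%Z.
Proof.
move=> [f /proper_coloring_generator fg].
have fg2 i x : f (x + g i *+ 2) = f x.
  apply: (@two_colors _ (f (x + g i))).
    by rewrite mulr2n addrA; apply: fg.
  by move=> e; apply: (fg i x).
have fgB i x : f (x + (g i - g 0)) = f x.
  rewrite addrA addrAC; apply: (@two_colors _ (f (x - g 0))); first exact: fg.
  by move=> e; apply: (fg 0 (x - g 0)); rewrite subrK.
have even_sum n0 n1 n2 : g 0 *~ n0 + g 1 *~ n1 + g 2 *~ n2 = 0 ->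
    (2 %| n0 + n1 + n2)%Z.
  set s := n0 + n1 + n2 => rel.
  have relE : g 0 *~ (s %% 2)%Z + (g 0 *+ 2) *~ (s %/ 2)%Z
      + (g 1 - g 0) *~ n1 + (g 2 - g 0) *~ n2 = 0.
    rewrite -rel pmulrn -mulrzA -mulrzDr !mulrzBl.
    have -> : (s %% 2)%Z + 2%:Z * (s %/ 2)%Z = s.
      by rewrite [RHS](divz_eq _ 2); ring.
    rewrite !mulrzDr -(addrA _ (_ - _)) [X in _ + X]addrACA -opprD.
    rewrite -(addrA (g 0 *~ n0)).
    by rewrite addrCA addrK addrC addrA.
  have : f (g 0 *~ (s %% 2)%Z) = f 0.
    by rewrite -[in RHS]relE !(period_mulrz (fgB _)) (period_mulrz (fg2 0)).
  have [/dvdz_mod0P //|->] : (s %% 2)%Z = 0 \/ (s %% 2)%Z = 1 by lia.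
  by rewrite mulr1z => e; case: (fg 0 0); rewrite add0r.
by split; apply: even_sum; apply: column_relation.
Qed.

(** Subtracting l times the second relation from the first leaves [g 0] + r([g 1] + [g 2]) = 0.
    Hence [g 1] + [g 2] is a generator up to sign, and triangular rigidity applies to the second
    relation. *)
Lemma triangular_SACG_not_colorable (r a b l : int) : `|r| = 1 ->
  M 0 0 = 1 -> M 0 1 = 0 -> M 1 1 = a -> M 2 1 = b ->
  M 1 0 = r + l * a -> M 2 0 = r + l * b ->
  colorable (SACG M) 3 -> (3 %| a + b)%Z.
Proof.
move=> r1 M00 M01 M11 M21 M10 M20 [f /proper_coloring_generator fg].
have rel1 := column_relation 1; have := column_relation 0.
rewrite M01 mulr0z add0r M11 M21 in rel1.
rewrite M00 M10 M20 mulr1z !mulrzDr ![l * _]mulrC !mulrzA -addrA addrACA.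
rewrite -[_ *~ a *~ l + _]mulrzDl rel1 mul0rz addr0 -mulrzDl => rel0.
apply: (triangular_not_three_colorable (fg 1) (fg 2) _ rel1) => x.
have [r_1|r_1] : r = 1 \/ r = -1 by lia.
  move: rel0; rewrite r_1 mulr1z addrC => /(canRL (addrK _)); rewrite sub0r => ->.
  by move=> e; apply: (fg 0 (x - g 0)); rewrite subrK.
move: rel0; rewrite r_1 mulrN1z => /(canRL (addrNK _)); rewrite add0r => <-.
exact: fg.
Qed.

(** The relations read [g 1] = 2 [g 2] and [g 0] = -3k [g 2]. The first makes 3 [g 2] a period of
    any 3-colouring, so the generator [g 0] would preserve colours. *)
Lemma type5_SACG_not_colorable (k : int) :
  M 0 0 = 1 -> M 0 1 = 0 -> M 1 1 = -1 -> M 2 1 = 2 ->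
  M 1 0 = 0 -> M 2 0 = 3 * k -> ~ colorable (SACG M) 3.
Proof.
move=> M00 M01 M11 M21 M10 M20 [f /proper_coloring_generator fg].
have := column_relation 0; have := column_relation 1.
rewrite M00 M01 M11 M21 M10 M20 !mulr0z mulr1z add0r addr0 mulrN1z -pmulrn.
move=> /(canRL (addNKr _)); rewrite addr0 => g1E.
rewrite mulrzA -pmulrn => rel0.
have fg3 := three_coloring_period (fg 2) (_ : forall x, f (x + g 2 *+ 2) <> f x).
have {}fg3 := fg3 ltac:(by rewrite g1E; apply: fg).
apply: (fg 0 0); rewrite -[in RHS]rel0 add0r.
by rewrite (period_mulrz fg3).
Qed.

End ThreeRows.

(** * Recognizing the six types *)

Lemma six_types_entries (M : 'M[int]_(3, 2)) :
  modified_hermite M -> six_types M ->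
  [/\ M 0 0 = 1, M 0 1 = 0 &
    (exists2 k : int, k != 0 &
      [/\ M 1 0 = 0, M 2 0 = 3 * k, M 1 1 = -1 & M 2 1 = 2]) \/
    (exists r l : int,
      [/\ `|r| = 1, M 1 0 = r + l * M 1 1 /\ M 2 0 = r + l * M 2 1,
          4 <= `|M 2 1| \/ M 1 1 = M 2 1 /\ `|M 1 1| = 2
        & ~~ (3 %| (M 1 1 + M 2 1)%R)%Z])].
Proof.
move=> [_ [_ _ _ _ [abs_y norm_y]]].
have mx32E y11 y12 y21 y22 y31 y32 : M = mx32 y11 y12 y21 y22 y31 y32 ->
    [/\ M 0 0 = y11, M 0 1 = y12, M 1 0 = y21 & [/\ M 1 1 = y22, M 2 0 = y31 & M 2 1 = y32]].
  by move=> ->; rewrite !mxE.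
move=> six; move: six abs_y norm_y.
case=> [[k k_gt0 [|]]|[[k k_gt0 [|]]|[[k k_gt0]|[[k k_gt0]|[[k k_neq0]|[a [k [a3 k_gt0]]]]]]]]
  /mx32E[-> -> -> [-> -> ->]] abs_y norm_y; split=> //.
- by right; exists (-1), 1; split; lia.
- by right; exists 1, (-1); split; lia.
(* For k = 1 the entry y32 = 2 is too small for the four-colour condition, but the matrix is then of
   the fifth type with b = 1. *)
- have [->|k_gt1] : k = 1 \/ 1 < k by lia.
    by left; exists 1.
  by right; exists 1, 1; split; lia.
- have [->|k_gt1] : k = 1 \/ 1 < k by lia.
    by left; exists (-1).
  by right; exists (-1), (-1); split; lia.
- by right; exists 1, (-1); split; lia.
- by right; exists 1, 1; split; lia.
- by left; exists k.
(* Here y21 = -1 gives |a| >= 2, and |a| <= |b| with a = b modulo 3 leaves |b| >= 4 or a = b with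
   |a| = 2. *)
- by right; exists (-1), 0; split; lia.
Qed.


(** The bound 2|r + la| <= |a| with |r| = 1 forces |l| <= 1. The value l = 0 gives the sixth type; l
    = 1 or -1 forces |a| <= 2 and gives the first four. *)
Lemma unit_diagonal_six_types (r l a n : int) :
  `|r| = 1 -> 0 < n -> ~~ (3 %| a)%Z -> `|a| <= `|a + 3 * n| ->
  - `|a| <= 2 * (r + l * a) <= 0 ->
  six_types (mx32 1 0 (r + l * a) a (r + l * (a + 3 * n)) (a + 3 * n)).
Proof.
move=> r1 n_gt0 a3 abs_a norm_p.
have l_small : 2 <= `|l| -> 2 * `|a| <= `|l * a|.
  by move=> l_ge2; rewrite normrM ler_wpM2r.
have [l0|[l1|l1]] : l = 0 \/ l = 1 \/ l = -1 by lia.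
- have {}r1 : r = -1 by move: norm_p; rewrite l0 mul0r; lia.
  do 5!right; exists a, (n + 1); split=> //; first lia.
  by congr mx32; rewrite ?r1 ?l0; ring.
- have {l_small norm_p} [[a1 r_1]|[[a1 r_1]|[a1 r_1]]] :
      (a = 1 /\ r = -1) \/ (a = -1 /\ r = 1) \/ (a = -2 /\ r = 1).
    by move: norm_p; rewrite l1 mul1r; lia.
  + by left; exists n => //; left; congr mx32; rewrite ?r_1 ?l1 ?a1; ring.
  + by right; left; exists n => //; left; congr mx32; rewrite ?r_1 ?l1 ?a1; ring.
  + by do 3!right; left; exists n => //; congr mx32; rewrite ?r_1 ?l1 ?a1; ring.
- have {l_small norm_p} [[a1 r_1]|[[a1 r_1]|[a1 r_1]]] :
      (a = 1 /\ r = 1) \/ (a = -1 /\ r = -1) \/ (a = 2 /\ r = 1).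
    by move: norm_p; rewrite l1 mulN1r; lia.
  + by left; exists n => //; right; congr mx32; rewrite ?r_1 ?l1 ?a1; ring.
  + by right; left; exists n => //; right; congr mx32; rewrite ?r_1 ?l1 ?a1; ring.
  + by do 2!right; left; exists n => //; congr mx32; rewrite ?r_1 ?l1 ?a1; ring.
Qed.

Lemma pivot1_circular_or_six_types (p q a b : int) :
  ~ (p = 0 /\ q = 0) -> ~ (p = 0 /\ a = 0) -> (a = b %[mod 3])%Z ->
  a <= b -> `|a| <= `|b| -> a = 0 \/ - `|a| <= 2 * p <= 0 ->
  circular 2 1 p q a b \/ six_types (mx32 1 0 p a q b).
Proof.
move=> pq0 pa0 ab_mod le_ab abs_ab norm_p.
(* Since a = b modulo 3, (t2, t3) = (1/3, 2/3) always solves the second equation; it fails only if p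
   = q modulo 3. If 3 divides a, then (1/3, 1/3) is also available, and failure of both means that 3
   divides p. *)
have [pq|pq] := boolP (3 %| p * 1 + q * 2)%Z; last first.
  by left; apply: (circular_thirds _ _ pq); lia.
have [a3_p|a3_pn] := boolP ((3 %| a)%Z && ~~ (3 %| p * 1 + q * 1)%Z).
  by left; apply: (@circular_thirds _ _ _ _ 1 1); lia.
have [a0|a_neq0] : a = 0 \/ a != 0 by lia.
  have [|t [m [t_in tE]]] :=
      @affine_hits_int p (1 / 2 + q%:~R / 3) (1 / 3) (2 / 3).
    have : 3%:~R <= `|p|%:~R :> rat; last by lra.
    by rewrite ler_int; lia.
  left; exists (1 / 2), t, (1 / 3), m, (b %/ 3)%Z.
  rewrite /arc_point a0; split; try lra.
  by have := @intr_divz 3 b ltac:(lia); lra.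
have {}norm_p : - `|a| <= 2 * p <= 0 by lia.
have [n bE] : exists n, b = a + 3 * n by exists ((b - a) %/ 3)%Z; lia.
have [c qE] : exists c, q = p + 3 * c by exists ((q - p) %/ 3)%Z; lia.
have n_ge0 : 0 <= n by lia.
have [/dvdzP[l cE]|nc] := boolP (n %| c)%Z; last first.
  by left; rewrite bE qE; apply: circular_antidiagonal.
have [n0|n_gt0] : n = 0 \/ 0 < n by lia.
  have qp : q = p by rewrite qE cE n0; lia.
  have ba : b = a by lia.
  have [p1|p_ge2] : p = -1 \/ 2 <= `|p| by lia.
    right; do 5!right; exists a, 1; split; [lia|lia|].
    by congr (mx32 _ _ _ _ _ _); lia.
  by left; rewrite qp ba; apply: circular_equal; lia.
(* Removing l times the second column makes the last two entries of the first column both equal to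
   r. *)
set r := p - l * a.
have pE : p = r + l * a by rewrite /r; ring.
have {}qE : q = r + l * b by rewrite qE cE bE /r; ring.
have [r_ge2|r_lt2] := lerP 2 `|r|.
  (* For n = 1, the conditions |a| <= |a + 3| and a nonzero leave a = -1 or a >= 1. If a = -1, the
     bound on p gives p = 0, which is the fifth type. *)
  have [a_n1|a_n1] := boolP ((a == -1) && (n == 1)).
    have p0 : p = 0 by lia.
    right; do 4!right; left; exists c; first by lia.
    by congr (mx32 _ _ _ _ _ _); lia.
  left; rewrite pE qE; apply: circular_column_op; rewrite bE.
  have [n1|n_ge2] : n = 1 \/ 2 <= n by lia.
    by rewrite n1; apply: circular_diagonal1; lia.
  exact: circular_diagonal_ge2.
have r_neq0 : r != 0.
  apply/eqP => r0; move: pE qE; rewrite r0 !add0r => pE qE.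
  have [l0|l_neq0] : l = 0 \/ 1 <= `|l| by lia.
    by apply: pq0; rewrite pE qE l0 !mul0r.
  have : `|a| <= `|l * a| by rewrite normrM ler_peMl.
  by rewrite -pE; lia.
have a3 : ~~ (3 %| a)%Z.
  apply/negP => a3; have /dvdzP[a' a'E] := a3; move: r_lt2 r_neq0.
  have /dvdzP[p' p'E] : (3 %| p)%Z by lia.
  by rewrite /r p'E a'E mulrA -mulrBl; lia.
right; move: abs_ab norm_p; rewrite pE qE bE => abs_ab norm_p.
by apply: unit_diagonal_six_types => //; lia.
Qed.

(** * Assembling the chromatic numbers *)

Lemma not_six_types_colorable3 (M : 'M[int]_(3, 2)) :
  modified_hermite M -> ~ loop_columns M -> ~ six_types M ->
  colorable (SACG M) 3.
Proof.
move=> [rowM [y11_gt0 y12_0 y_mod le_y [abs_y norm_y]]] no_loop no_six.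
have row0 i : ~ (M i 0 = 0 /\ M i 1 = 0).
  move=> [Mi0 Mi1]; case/eqP: (rowM i); apply/rowP => j; rewrite !mxE.
  by case: j => [[|[|//]] j_lt]; [rewrite -[RHS]Mi0|rewrite -[RHS]Mi1];
    congr (M i _); apply: val_inj.
have no_loop0 : M 0 0 = 1 -> ~ (M 1 0 = 0 /\ M 2 0 = 0).
  move=> M00 [M10 M20]; apply: no_loop; left; apply/colP => i; rewrite !mxE.
  case: i => [[|[|[|//]]] i_lt] /=; [rewrite -[RHS]M00|rewrite -[RHS]M10|rewrite -[RHS]M20];
    by congr (M _ _); apply: val_inj.
have no_loop1 : ~ (M 1 1 = 0 /\ M 2 1 = 1).
  move=> [M11 M21]; apply: no_loop; right; apply/colP => i; rewrite !mxE.
  case: i => [[|[|[|//]]] i_lt] /=; [rewrite -[RHS]y12_0|rewrite -[RHS]M11|rewrite -[RHS]M21];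
    by congr (M _ _); apply: val_inj.
(* If y32 = 0 then y22 = 0, and either normalization bound makes y21 or y31 vanish, giving a zero
   row. *)
have y32_neq0 : M 2 1 != 0.
  by have := row0 1; have := row0 2; lia.
apply: circular_SACG_colorable => //.
have [y11_ge3|[y11_2|y11_1]] : 3 <= M 0 0 \/ M 0 0 = 2 \/ M 0 0 = 1 by lia.
- exact: circular_pivot_ge3.
- rewrite y11_2 in y_mod *.
  have [n ->] : exists n, M 2 1 = M 1 1 + 3 * n.
    by exists ((M 2 1 - M 1 1)%R %/ 3)%Z; lia.
  exact: circular_pivot2.
rewrite y11_1 !mul1r in y_mod *.
have [] // := @pivot1_circular_or_six_types (M 1 0) (M 2 0) (M 1 1) (M 2 1).
- exact: no_loop0.
- by case: norm_y => [[-> _]|]; [left|right].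
move=> six; case: no_six; move: six; congr six_types.
apply/matrixP => i j; rewrite !mxE.
case: i => [[|[|[|//]]] i_lt]; case: j => [[|[|//]] j_lt] /=;
  [rewrite -[LHS]y11_1|rewrite -[LHS]y12_0|..];
  by congr (M _ _); apply: val_inj.
Qed.

Theorem theorem2p14 (M : 'M[int]_(3, 2)) (hM : modified_hermite M) :
  [/\ loop_columns M ->
        has_loops (SACG M) /\
        (forall (C : Type) (f : heuberger_group M -> C),
           ~ proper_coloring (SACG M) f),
      even_columns M -> has_chromatic_number (SACG M) 2,
      six_types M -> has_chromatic_number (SACG M) 4
    & ~ loop_columns M -> ~ even_columns M -> ~ six_types M ->
        has_chromatic_number (SACG M) 3].
Proof.
have M01 : M 0 1 = 0 by case: hM => _ [].
have lower k : ~ colorable (SACG M) k ->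
    forall l, colorable (SACG M) l -> (k < l)%N.
  move=> not_k l col_l; rewrite ltnNge; apply/negP => lk.
  by apply: not_k; apply: colorable_leq col_l.
split.
- have loop (i : 'I_3) : heuberger_class M (delta_mx i 0) = 0 ->
      has_loops (SACG M) /\ (forall (C : Type) (f : heuberger_group M -> C),
        ~ proper_coloring (SACG M) f).
    move=> gi; have adj0 : SACG M 0 0.
      by exists i; left; rewrite gi subrr.
    by split=> [|C f /(_ _ _ adj0)]; [exists 0|].
  by case=> colM; [apply: (loop 0)|apply: (loop 2)];
    rewrite -colM heuberger_class_col.
- move=> [even0 even1]; split; last first.
    apply: lower => -[f fP].
    by apply: (fP _ _ (SACG_generator 0 0)); rewrite [LHS]ord1 [RHS]ord1.
  apply: circular_SACG_colorable => //.
  (* At this point the dot products are half the column sums. *)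
  exists (1 / 2), (1 / 2), (1 / 2), ((M 0 0 + M 1 0 + M 2 0)%R %/ 2)%Z,
    ((M 1 1 + M 2 1)%R %/ 2)%Z.
  move: (intr_divz even0) (intr_divz even1); rewrite /arc_point !intrD.
  by split; lra.
- move=> six; have [M00 _ types] := six_types_entries hM six; split; last first.
    apply: lower => col3.
    case: types => [[k _ [M10 M20 M11 M21]]|[r [l [r1 [M10 M20] _ /negP]]]].
      exact: (type5_SACG_not_colorable M00 M01 M11 M21 M10 M20 col3).
    apply.
    exact: (triangular_SACG_not_colorable r1 M00 M01 erefl erefl M10 M20 col3).
  apply: circular_SACG_colorable => //; rewrite M00.
  case: types => [[k k_neq0 [-> -> -> ->]]|[r [l [r1 [-> ->] ab _]]]].
    exact: circular4_type5.
  by apply: circular_column_op; apply: circular_diagonal4.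
- move=> no_loop not_even no_six; split.
    exact: not_six_types_colorable3.
  apply: lower => /colorable2_even[even0 even1]; apply: not_even.
  by split=> //; move: even1; rewrite M01 add0r.
Qed.
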